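(* The SOS rank of any $3\times 3$ positive semidefinite diagonal biquadratic form $$P(\mathbf{x},\mathbf{y})=\sum_{i=1}^{3}\sum_{j=1}^{3} a_{ij}x_i^2y_j^2,\qquad a_{ij}\in\mathbb{R},\ a_{ij}\ge 0,$$ satisfies $\operatorname{sos}(P)\le 7$.
   Context: Here $\mathbf{x}=(x_1,x_2,x_3)$ and $\mathbf{y}=(y_1,y_2,y_3)$ are real variables. A diagonal biquadratic form is one of the shape $\sum_{i,j}a_{ij}x_i^2y_j^2$ with real $a_{ij}$; it is positive semidefinite (nonnegative for all real $\mathbf{x},\mathbf{y}$) if and only if all $a_{ij}\ge 0$. A bilinear form is a polynomial $\sum_{i,j} c_{ij}x_iy_j$ with real coefficients. A biquadratic form $P$ is SOS if it is a finite sum of squares of bilinear forms; its SOS rank $\operatorname{sos}(P)$ is the smallest number of squares of bilinear forms in such a representation. *)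

(* Defs.v *)
From mathcomp Require Export all_boot all_order all_algebra.
From mathcomp Require Export reals mpoly.

Set Implicit Arguments.
Unset Strict Implicit.
Unset Printing Implicit Defensive.

Import Order.TTheory GRing.Theory Num.Theory.
Local Open Scope ring_scope.

(* Polynomials in x_0, ..., x_(m-1), y_0, ..., y_(n-1) live in                *)
(* {mpoly R[m + n]}; the x's are the first m variables, the y's the last n.   *)
Definition xvar (R : realType) (m n : nat) (i : 'I_m) : {mpoly R[m + n]} :=
  'X_(lshift n i).

Definition yvar (R : realType) (m n : nat) (j : 'I_n) : {mpoly R[m + n]} :=
  'X_(rshift m j).

Definition bilinear_form (R : realType) (m n : nat) (B : {mpoly R[m + n]}) :
    Prop :=
  exists c : 'M[R]_(m, n),
    B = \sum_(i < m) \sum_(j < n) c i j *: (xvar R n i * yvar R m j).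

Definition diag_biquadratic (R : realType) (m n : nat) (a : 'M[R]_(m, n)) :
    {mpoly R[m + n]} :=
  \sum_(i < m) \sum_(j < n) a i j *: (xvar R n i ^+ 2 * yvar R m j ^+ 2).

Definition psd_form (R : realType) (m n : nat) (P : {mpoly R[m + n]}) : Prop :=
  forall v : 'I_(m + n) -> R, 0 <= P.@[v].

Definition sum_of_squares (R : realType) (m n : nat) (P : {mpoly R[m + n]})
    (k : nat) : Prop :=
  exists B : 'I_k -> {mpoly R[m + n]},
    (forall l, bilinear_form (B l)) /\ P = \sum_(l < k) B l ^+ 2.

(* sos(P) = r.  This is a relation because sos(P) is defined only when P is   *)
(* SOS, so "sos(P) <= N" is rendered as "sos(P) = r for some r <= N".         *)
Definition sos_rank (R : realType) (m n : nat) (P : {mpoly R[m + n]})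
    (r : nat) : Prop :=
  sum_of_squares P r /\ forall k : nat, sum_of_squares P k -> (r <= k)%N.

Lemma psd_diag_biquadraticP (R : realType) (m n : nat) (a : 'M[R]_(m, n)) :
  psd_form (diag_biquadratic a) <-> forall i j, 0 <= a i j.
Proof.
have evE (v : 'I_(m + n) -> R) : (diag_biquadratic a).@[v] =
    \sum_(i < m) \sum_(j < n) a i j * (v (lshift n i) ^+ 2 * v (rshift m j) ^+ 2).
  rewrite /diag_biquadratic raddf_sum /=; apply: eq_bigr => i _.
  rewrite raddf_sum /=; apply: eq_bigr => j _.
  by rewrite mevalZ mevalM !expr2 !mevalM /xvar /yvar !mevalXU.
split=> [Ppsd i j | a_ge0 v]; last first.
  rewrite evE; apply: sumr_ge0 => i _; apply: sumr_ge0 => j _.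
  by rewrite mulr_ge0 // mulr_ge0 // sqr_ge0.
pose v k : R := ((k == lshift n i) || (k == rshift m j))%:R.
have := Ppsd v; rewrite evE (bigD1 i) //= (bigD1 j) //=.
rewrite big1 => [|j' ne_j]; last first.
  by rewrite /v eq_rlshift (inj_eq (@rshift_inj _ _)) (negPf ne_j) /= expr0n /= !mulr0.
rewrite big1 => [|i' ne_i]; last first.
  rewrite big1 // => j' _.
  by rewrite /v (inj_eq (@lshift_inj _ _)) (negPf ne_i) eq_lrshift /= expr0n /= mul0r mulr0.
by rewrite /v !eqxx orbT /= !expr1n !mulr1 !addr0.
Qed.

(* Main.v *)
Require Import Defs.
From mathcomp Require Import boolp perm ring.

Set Implicit Arguments.
Unset Strict Implicit.

Import Order.TTheory GRing.Theory Num.Theory.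
Local Open Scope ring_scope.

(** Written out, [P] is a sum of nine squares, one for each cell [(i, j)] of
    the coefficient matrix. Two of these nine can be saved, because the
    products [u = x_i y_j], [v = x_k y_l], [p = x_i y_l], [q = x_k y_j]
    attached to a 2x2 block satisfy the syzygy [u v = p q].

    Let a, d be the coefficients of u^2, v^2 on one diagonal of the block and
    b, c those of p^2, q^2 on the other. If [b c <= a d] then
      [b p^2 + c q^2 = (sqrt b p - sqrt c q)^2 + 2 sqrt (b c) u v],
    and the cross term is absorbed by completing the square in [u]; this leaves
    [e v^2] with [e = d - b c / a >= 0] ([two_squares_off_block]). Four cells
    have thus become two squares together with a cell [v] whose coefficient is
    still nonnegative, so that [v] can be used again in a second block.

    Swapping the first two columns if necessary, the leading 2x2 block of the
    matrix satisfies [a_01 a_10 <= a_00 a_11]; treat it as above with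
    [v = x_1 y_1]. The trailing 2x2 block meets the leading one in exactly that
    cell, so it is still a diagonal form with nonnegative coefficients, and it
    takes three squares ([block_three_squares]). The two corner cells
    outside both blocks take one square each, and 2 + 3 + 2 = 7. *)

Section SquareSums.
Variables (R : realType) (m n : nat).
Implicit Types (P Q : {mpoly R[m + n]}) (u v p q : {mpoly R[m + n]}).

Lemma bilinear_formZ (t : R) u : bilinear_form u -> bilinear_form (t *: u).
Proof.
move=> [c ->]; exists (t *: c); rewrite scaler_sumr; apply: eq_bigr => i _.
by rewrite scaler_sumr; apply: eq_bigr => j _; rewrite mxE scalerA.
Qed.

Lemma bilinear_formD u v :
  bilinear_form u -> bilinear_form v -> bilinear_form (u + v).
Proof.
move=> [c ->] [d ->]; exists (c + d); rewrite -big_split; apply: eq_bigr => i _.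
by rewrite -big_split; apply: eq_bigr => j _; rewrite mxE scalerDl.
Qed.

Lemma bilinear_form_cell i j : bilinear_form (xvar R n i * yvar R m j).
Proof.
exists (delta_mx i j); rewrite (bigD1 i) //= (bigD1 j) //= mxE !eqxx scale1r.
rewrite big1 => [|l /negPf ne_l]; last by rewrite mxE ne_l andbF scale0r.
rewrite big1 ?addr0 // => k /negPf ne_k.
by rewrite big1 // => l _; rewrite mxE ne_k scale0r.
Qed.

Lemma sum_of_squaresD P Q k l :
  sum_of_squares P k -> sum_of_squares Q l -> sum_of_squares (P + Q) (k + l).
Proof.
move=> [B [Bbil ->]] [C [Cbil ->]].
exists (fun i => match split i with inl j => B j | inr j => C j end); split.
  by move=> i; case: (split i).
rewrite big_split_ord /=; congr (_ + _); apply: eq_bigr => i _.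
  by rewrite (unsplitK (inl i)).
by rewrite (unsplitK (inr i)).
Qed.

Lemma sum_of_squares_sqr u : bilinear_form u -> sum_of_squares (u ^+ 2) 1.
Proof. by move=> ubil; exists (fun=> u); split=> //; rewrite big_ord1. Qed.

Lemma sum_of_squaresZ_sqr (t : R) u :
  0 <= t -> bilinear_form u -> sum_of_squares (t *: u ^+ 2) 1.
Proof.
move=> t_ge0 ubil; rewrite -(sqr_sqrtr t_ge0) -exprZn.
exact/sum_of_squares_sqr/bilinear_formZ.
Qed.

(** The partial step of the argument: [v] survives with a smaller but
    nonnegative coefficient, ready to take part in another block. *)
Lemma two_squares_off_block (a b c d : R) u v p q :
    0 <= a -> 0 <= b -> 0 <= c -> 0 <= d -> b * c <= a * d ->
    bilinear_form u -> bilinear_form v -> bilinear_form p -> bilinear_form q ->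
    u * v = p * q ->
  exists2 e, 0 <= e & exists2 Q, sum_of_squares Q 2 &
    a *: u ^+ 2 + d *: v ^+ 2 + b *: p ^+ 2 + c *: q ^+ 2 = Q + e *: v ^+ 2.
Proof.
move=> a0 b0 c0 d0 le_bc_ad ubil vbil pbil qbil uvpq.
pose α := Num.sqrt a; pose β := Num.sqrt b; pose γ := Num.sqrt c.
have [aE bE cE] : [/\ a = α ^+ 2, b = β ^+ 2 & c = γ ^+ 2].
  by rewrite !sqr_sqrtr.
(* If a = 0, then b c = 0 too, so that the convention 0^-1 = 0 gives the
   right value k = 0. *)
pose k := β * γ / α.
have αk : α * k = β * γ.
  have [α0|α_neq0] := eqVneq α 0; last by rewrite mulrC divfK.
  apply/esym/eqP; rewrite α0 mul0r -sqrf_eq0 exprMn -bE -cE eq_le.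
  by rewrite mulr_ge0 // andbT (le_trans le_bc_ad) // aE α0 expr0n mul0r.
exists (d - k ^+ 2).
  rewrite subr_ge0; have [α0|α_neq0] := eqVneq α 0.
    by rewrite /k α0 invr0 mulr0 expr0n.
  have a_gt0 : 0 < a by rewrite lt_def a0 aE sqrf_eq0 α_neq0.
  by rewrite -(ler_pM2l a_gt0) {1}aE -exprMn αk exprMn -bE -cE.
exists ((β *: p + (- γ) *: q) ^+ 2 + (α *: u + k *: v) ^+ 2).
  by apply: (@sum_of_squaresD _ _ 1 1); apply: sum_of_squares_sqr;
    apply: bilinear_formD; apply: bilinear_formZ.
rewrite !sqrrD !exprZn sqrrN -aE -bE -cE.
rewrite -!scalerAl -!scalerAr !scalerA uvpq αk mulrN scaleNr mulNrn scalerBl.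
ring.
Qed.

(** One of the two diagonals of the block has the larger product, and that is
    the one on which the square is completed. *)
Lemma block_three_squares (a b c d : R) u v p q :
    0 <= a -> 0 <= b -> 0 <= c -> 0 <= d ->
    bilinear_form u -> bilinear_form v -> bilinear_form p -> bilinear_form q ->
    u * v = p * q ->
  sum_of_squares (a *: u ^+ 2 + d *: v ^+ 2 + b *: p ^+ 2 + c *: q ^+ 2) 3.
Proof.
move=> a0 b0 c0 d0 ubil vbil pbil qbil uvpq.
have [le_bc_ad|/ltW le_ad_bc] := leP (b * c) (a * d).
  have [e e0 [Q Qsos ->]] :=
    two_squares_off_block a0 b0 c0 d0 le_bc_ad ubil vbil pbil qbil uvpq.
  by apply: (@sum_of_squaresD _ _ 2 1) => //; apply: sum_of_squaresZ_sqr.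
have [e e0 [Q Qsos eqQ]] :=
  two_squares_off_block b0 a0 d0 c0 le_ad_bc pbil qbil ubil vbil (esym uvpq).
have -> : a *: u ^+ 2 + d *: v ^+ 2 + b *: p ^+ 2 + c *: q ^+ 2
    = Q + e *: q ^+ 2 by rewrite -eqQ; ring.
by apply: (@sum_of_squaresD _ _ 2 1) => //; apply: sum_of_squaresZ_sqr.
Qed.

(** The set of achievable numbers of squares is not decidable a priori, hence
    the classical detour to take its minimum. *)
Lemma sos_rank_le P k :
  sum_of_squares P k -> exists r, sos_rank P r /\ (r <= k)%N.
Proof.
move=> Pk; have Pex : exists l, `[< sum_of_squares P l >].
  by exists k; apply/asboolP.
case: (ex_minnP Pex) => r /asboolP Pr r_min.
exists r; split; last exact/r_min/asboolP.
by split=> // l Pl; apply/r_min/asboolP.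
Qed.

Lemma diag_biquadratic_col_perm (a : 'M[R]_(m, n)) (s : 'S_n) :
  diag_biquadratic a = \sum_(i < m) \sum_(j < n)
    a i (s j) *: (xvar R n i * yvar R m (s j)) ^+ 2.
Proof.
apply: eq_bigr => i _; rewrite (reindex_inj (@perm_inj _ s)) /=.
by apply: eq_bigr => j _; rewrite exprMn.
Qed.

End SquareSums.

(** The column permutation [s] lets the identity and a transposition cover the
    two possible signs of the leading 2x2 minor of [a]. *)
Lemma seven_squares_of_leading_minor (R : realType) (a : 'M[R]_(3, 3))
    (s : 'S_3) :
    (forall i j, 0 <= a i j) ->
    a 0 (s 1) * a 1 (s 0) <= a 0 (s 0) * a 1 (s 1) ->
  sum_of_squares (diag_biquadratic a) 7.
Proof.
move=> a_ge0 minor_ge0; rewrite (diag_biquadratic_col_perm a s).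
pose z (i j : 'I_3) := xvar R 3 i * yvar R 3 (s j).
have zbil i j : bilinear_form (z i j) by apply: bilinear_form_cell.
have zz i j k l : z i j * z k l = z i l * z k j by rewrite /z; ring.
pose o2 : 'I_3 := lift 0 (lift 0 0).
have [e e0 [Q Qsos eqQ]] :=
  two_squares_off_block (a_ge0 _ _) (a_ge0 _ _) (a_ge0 _ _) (a_ge0 _ _)
    minor_ge0 (zbil 0 0) (zbil 1 1) (zbil 0 1) (zbil 1 0) (zz 0 0 1 1).
have Tsos : sum_of_squares (e *: z 1 1 ^+ 2 + a o2 (s o2) *: z o2 o2 ^+ 2
    + a 1 (s o2) *: z 1 o2 ^+ 2 + a o2 (s 1) *: z o2 1 ^+ 2) 3.
  exact: block_three_squares.
have corner i j : sum_of_squares (a i (s j) *: z i j ^+ 2) 1.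
  exact: sum_of_squaresZ_sqr.
have := sum_of_squaresD (sum_of_squaresD (sum_of_squaresD Qsos Tsos)
  (corner 0 o2)) (corner o2 0).
congr sum_of_squares; rewrite !addrA -eqQ !big_ord_recl !big_ord0 /= -/o2.
(* The expansion of the sums spells the middle index as a lift. *)
have -> : lift ord0 ord0 = 1 :> 'I_3 by apply: val_inj.
rewrite -/(z _ _).
ring.
Qed.

Theorem theorem3p1 (R : realType) (a : 'M[R]_(3, 3))
    (Ppsd : psd_form (diag_biquadratic a)) :
  exists r : nat, sos_rank (diag_biquadratic a) r /\ (r <= 7)%N.
Proof.
have a_ge0 := (psd_diag_biquadraticP a).1 Ppsd.
apply: sos_rank_le.
have [minor_ge0|/ltW minor_le0] :=
    leP (a 0 1 * a 1 0) (a 0 0 * a 1 1).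
  by apply: (@seven_squares_of_leading_minor _ _ 1%g); rewrite ?perm1.
apply: (@seven_squares_of_leading_minor _ _ (tperm 0 1)) => //.
by rewrite tpermL tpermR.
Qed.
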